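(* Let $R$ be a ring, and let $a,b,c\in R$. If $aba=aca$, then $1+ac$ has Hirano inverse if and only if $1+ba$ has Hirano inverse.
   Context: All rings are associative with identity. $N(R)$ denotes the set of all nilpotent elements of $R$. An element $x\in R$ has Hirano inverse if there exists $y\in R$ such that $x^2-xy\in N(R)$, $xy=yx$ and $y=yxy$. *)

(* Defs.v *)
From mathcomp Require Import all_boot all_algebra.

Set Implicit Arguments.
Unset Strict Implicit.
Unset Printing Implicit Defensive.

Import GRing.Theory.
Local Open Scope ring_scope.

(* The exponent 0 is harmless: x ^+ 0 = 0 means 1 = 0, which forces x = 0. *)
Definition nilpotent_elt (R : pzRingType) (x : R) : Prop :=
  exists n : nat, x ^+ n = 0.

Definition has_Hirano_inverse (R : pzRingType) (x : R) : Prop :=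
  exists y : R,
    [/\ nilpotent_elt (x ^+ 2 - x * y), x * y = y * x & y = y * x * y].

(* Main.v *)
Require Import Defs.
From mathcomp Require Import all_boot all_algebra.

Import GRing.Theory.
Local Open Scope ring_scope.

(** An element [x] has a Hirano inverse exactly when [x - x ^+ 3] is nilpotent
    ([Hirano_inverseP]); this removes the existential quantifier over inverses.

    If [y] is a Hirano inverse, then [e = x * y] is an idempotent and
    [x ^+ 2 = e + w] with [w] nilpotent, so [x ^+ 2] is idempotent up to a
    multiple of [w], and so [(x - x ^+ 3) ^+ 2] is a multiple of [w]
    ([Hirano_inverse_nilpotent]).  Conversely, expanding
    [x ^+ n * (1 - x ^+ 2) ^+ n = 0] in the form [x ^+ n = x ^+ n.+1 * g] shows
    that [x] is strongly pi-regular, and its Drazin inverse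
    [x ^+ n * g ^+ n.+1] is a Hirano inverse ([nilpotent_Hirano_inverse]).

    It remains to compare [v = u - u ^+ 3] and [v' = u' - u' ^+ 3] for
    [u = 1 + a * c] and [u' = 1 + b * a].  The hypothesis
    [a * b * a = a * c * a] says that [a] intertwines [b * a] and [a * c], so
    [a * v' = v * a].  Since [t - t ^+ 3] vanishes at [t = 1], the element [v]
    starts with the factor [a * c] and [v'] ends with the factor [b * a]; hence
    a vanishing power of one of [v], [v'] makes the next power of the other
    vanish. *)

Lemma intertwineX {R : pzRingType} {a u v : R} (n : nat) :
  a * u = v * a -> a * u ^+ n = v ^+ n * a.
Proof.
move=> auv; elim: n => [|n IHn]; first by rewrite !expr0 mulr1 mul1r.
by rewrite exprSr mulrA IHn -mulrA auv mulrA -exprSr.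
Qed.

(** Both powers equal [e * v ^+ n], because [e * v = v * e = u * e] says that
    [e] intertwines [v] with itself and with [u].  When [e] is an idempotent,
    this replaces [u] by a simpler [v] on the part of the ring cut out by
    [e]. *)
Lemma eq_exprM_comm {R : pzRingType} {e u v : R} (n : nat) :
  GRing.comm e v -> u * e = v * e -> u ^+ n * e = v ^+ n * e.
Proof.
move=> ev uev; rewrite -(intertwineX n ev).
by apply/esym/intertwineX; rewrite uev.
Qed.

(** The left-hand side is divisible by [w] because modulo [w] the element
    [e + w] is the idempotent [e]. *)
Lemma idem_addM_subr1 {R : pzRingType} {e w : R} :
  e * e = e -> GRing.comm e w ->
  (e + w) * (1 - (e + w)) = w * (1 - e *+ 2 - w).
Proof.
move=> ee ew; rewrite mulr2n !(mulrDr, mulrDl, mulrN, opprD) !mulr1 ee.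
by rewrite -ew !addrA [e + w]addrC addrK.
Qed.

Lemma subr_expr3 {R : pzRingType} (x : R) : x - x ^+ 3 = x * (1 - x ^+ 2).
Proof. by rewrite mulrBr mulr1 -exprS. Qed.

Lemma Hirano_inverse_nilpotent {R : pzRingType} {x : R} :
  has_Hirano_inverse x -> nilpotent_elt (x - x ^+ 3).
Proof.
case=> y [[n wn0] xy yxy].
set e := x * y; set w := x ^+ 2 - e.
have ee : e * e = e by rewrite /e -mulrA (mulrA y) -yxy.
have xe : GRing.comm x e by rewrite /GRing.comm /e -mulrA -xy.
have xw : GRing.comm x w.
  by apply: commrB xe; apply: commrX.
have ew : GRing.comm e w.
  by apply: commrB => //; apply/commrX/commr_sym.
have x2E : x ^+ 2 = e + w by rewrite addrC subrK.
have xp : GRing.comm x (1 - x ^+ 2).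
  by apply: commrB; [apply: commr1 | apply: commrX].
set s := (1 - e *+ 2 - w) * (1 - x ^+ 2).
have sq : (x - x ^+ 3) ^+ 2 = w * s.
  rewrite subr_expr3 exprMn_comm // [X in _ * X]expr2 mulrA {1 2}x2E.
  by rewrite idem_addM_subr1 // mulrA.
have ws : GRing.comm w s.
  apply: commrM; apply: commrB => //; first apply: commrB.
  - exact: commr1.
  - by apply/commrMn/commr_sym.
  - exact: commr1.
  - by apply/commrX/commr_sym.
by exists (2 * n)%N; rewrite exprM sq exprMn_comm // wn0 mul0r.
Qed.

(** The Drazin inverse [y] of [x] works.  Its idempotent [e = x * y] splits [R]
    into two parts, and [x ^+ 2 - e] is nilpotent on each: on the part cut out
    by [1 - e] it is [x ^+ 2], and [x ^+ n] vanishes there; on the part cut out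
    by [e] it is [x ^+ 2 - 1], and [x] is invertible there, so
    [x ^+ n * (1 - x ^+ 2) ^+ n = 0] kills a power of it. *)
Lemma nilpotent_Hirano_inverse {R : pzRingType} {x : R} :
  nilpotent_elt (x - x ^+ 3) -> has_Hirano_inverse x.
Proof.
case=> n; set p := 1 - x ^+ 2.
have xp : GRing.comm x p.
  by apply: commrB; [apply: commr1 | apply: commrX].
rewrite subr_expr3 exprMn_comm // => xpn0.
(* [1 - p ^+ n] is divisible by [1 - p = x ^+ 2]. *)
pose g := x * \sum_(i < n) p ^+ i.
have xg : GRing.comm x g.
  by apply: commrM => //; apply: commr_sum => i _; apply: commrX.
have xgE : x * g = 1 - p ^+ n.
  rewrite /g mulrA -expr2 -opprB subrX1 -mulNr; congr (_ * _).
  by rewrite opprB /p subKr.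
have xng : x ^+ n * (x * g) = x ^+ n by rewrite xgE mulrBr xpn0 mulr1 subr0.
pose y := x ^+ n * g ^+ n.+1; pose e := (x * g) ^+ n.+1.
have xyE : x * y = e by rewrite /y mulrA -exprS /e exprMn_comm.
have xy : GRing.comm x y by apply: commrM; apply: commrX.
have xe : GRing.comm x e by rewrite -xyE; apply: commrM.
have xne : x ^+ n * e = x ^+ n.
  by rewrite /e; elim: n.+1 => [|m IHm]; rewrite ?mulr1 // exprS mulrA xng.
have gxn : GRing.comm (g ^+ n.+1) (x ^+ n).
  by apply/commrX/commr_sym/commrX.
have ye : y * e = y by rewrite /y -gxn -mulrA xne.
have pe : GRing.comm e p.
  by apply: commrB; [apply: commr1 | apply/commrX/commr_sym].
have pne0 : p ^+ n * e = 0.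
  have pxn0 : p ^+ n * x ^+ n = 0.
    by rewrite (commrX n (commr_sym (commrX n xp))).
  by rewrite -xyE xy /y !mulrA pxn0 !mul0r.
have ee : e * e = e by rewrite -{1}xyE -mulrA ye.
exists y; split=> //; last by rewrite -mulrA xyE ye.
exists n; rewrite xyE; set w := x ^+ 2 - e.
have wne0 : w ^+ n * e = 0.
  rewrite (@eq_exprM_comm _ _ _ (- p)).
  - by rewrite exprNn -mulrA pne0 mulr0.
  - exact: commrN.
  - by rewrite /p opprB !mulrBl ee mul1r.
have wnf0 : w ^+ n * (1 - e) = 0.
  rewrite (@eq_exprM_comm _ _ _ (x ^+ 2)).
  - by rewrite -exprM mulnC exprM expr2 -mulrA mulrBr mulr1 xne subrr mulr0.
  - by apply/commrX/commr_sym/commrB => //; apply: commr1.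
  - by rewrite mulrBl [e * _]mulrBr mulr1 ee subrr subr0.
by rewrite -[LHS]mulr1 -(subrK e 1) mulrDr wnf0 wne0 addr0.
Qed.

Lemma Hirano_inverseP {R : pzRingType} (x : R) :
  has_Hirano_inverse x <-> nilpotent_elt (x - x ^+ 3).
Proof.
by split; [apply: Hirano_inverse_nilpotent | apply: nilpotent_Hirano_inverse].
Qed.

(** Since [a * v' ^+ n = v ^+ n * a], either vanishing [n]-th power makes this
    common value vanish, and one more factor [r] or [s] turns it into the other
    [n.+1]-st power.  For [r = s] this is the classical transfer of nilpotency
    between [a * s] and [s * a]. *)
Lemma intertwine_nilpotent {R : pzRingType} {a r s v v' : R} :
  a * v' = v * a -> v = a * s -> v' = r * a ->
  nilpotent_elt v <-> nilpotent_elt v'.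
Proof.
move=> avv vE v'E; split=> -[n vn0]; exists n.+1.
  by rewrite exprS {1}v'E -mulrA (intertwineX n avv) vn0 mul0r mulr0.
by rewrite exprSr {2}vE mulrA -(intertwineX n avv) vn0 mulr0 mul0r.
Qed.

(** The root [u = 1] of [u - u ^+ 3] makes [t = u - 1] a factor; it is needed
    on both sides because [t] is [a * c] in one use, where [a] must come first,
    and [b * a] in the other, where [a] must come last. *)
Lemma add1_sub_expr3 {R : pzRingType} (t : R) :
  (1 + t) - (1 + t) ^+ 3 = t * - ((1 + t) + (1 + t) ^+ 2) /\
  (1 + t) - (1 + t) ^+ 3 = - ((1 + t) + (1 + t) ^+ 2) * t.
Proof.
set u := 1 + t; have tE : t = u - 1 by rewrite /u addrC addKr.
rewrite tE; split.
  by rewrite mulrN mulrBl mul1r mulrDr -expr2 -exprS opprB addrKA.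
by rewrite mulNr mulrBr mulr1 mulrDl -expr2 -exprSr opprB addrKA.
Qed.

Theorem theorem5p1 (R : pzRingType) (a b c : R)
  (habac : a * b * a = a * c * a) :
  has_Hirano_inverse (1 + a * c) <-> has_Hirano_inverse (1 + b * a).
Proof.
have au : a * (1 + b * a) = (1 + a * c) * a.
  by rewrite mulrDr mulrDl mulr1 mul1r mulrA habac.
apply: (iff_trans (Hirano_inverseP _)).
apply: (iff_trans _ (iff_sym (Hirano_inverseP _))).
apply: (@intertwine_nilpotent _ a).
- by rewrite mulrBr mulrBl au (intertwineX 3 au).
- by rewrite (add1_sub_expr3 _).1 -mulrA.
- by rewrite (add1_sub_expr3 _).2 mulrA.
Qed.
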